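(* Let $\mathcal{B} \subseteq \mathcal{A}$ be a unital inclusion of $C^*$-algebras. Then $\mathcal{B} \subseteq \mathcal{A}$ is $C^*$-irreducible if and only if each non-zero positive element in $\mathcal{A}$ is full relatively to $\mathcal{B}$. If $\mathcal{A}$ has property (SP), then it suffices to verify that each non-zero projection in $\mathcal{A}$ is full relatively to $\mathcal{B}$ (that is, if $\mathcal{A}$ has property (SP) and each non-zero projection in $\mathcal{A}$ is full relatively to $\mathcal{B}$, then $\mathcal{B}\subseteq\mathcal{A}$ is $C^*$-irreducible).
   Context: An inclusion $\mathcal{B} \subseteq \mathcal{A}$ of unital $C^*$-algebras is unital if the unit of $\mathcal{A}$ belongs to $\mathcal{B}$. A unital inclusion $\mathcal{B} \subseteq \mathcal{A}$ is called $C^*$-irreducible if each intermediate $C^*$-algebra $\mathcal{B} \subseteq \mathcal{D} \subseteq \mathcal{A}$ (including $\mathcal{D}=\mathcal{B}$ and $\mathcal{D}=\mathcal{A}$) is simple. A positive element $a \in \mathcal{A}$ is full relatively to $\mathcal{B}$ if there exist $x_1,\dots,x_n \in \mathcal{B}$ such that $\sum_{j=1}^n x_j^* a x_j \ge 1_{\mathcal{A}}$. A $C^*$-algebra has property (SP) if each of its non-zero hereditary sub-$C^*$-algebras contains a non-zero projection. *)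

(* Defs.v *)
From HB Require Import structures.
From mathcomp Require Import all_boot all_order all_algebra.
From mathcomp Require Import complex.
From mathcomp Require Import all_classical all_reals all_analysis.

Set Implicit Arguments.
Unset Strict Implicit.
Unset Printing Implicit Defensive.

Import Order.TTheory GRing.Theory Num.Theory.
Import numFieldNormedType.Exports.

Local Open Scope classical_set_scope.
Local Open Scope ring_scope.
Local Open Scope complex_scope.

(* Unital C*-algebras over C = R[i]. The norm is C-valued (it takes
   nonnegative real values), [^*] is complex conjugation, and 1 != 0, so the
   zero algebra is excluded. A plain record is used because Hierarchy-Builder
   rejects a structure joining rings and normed modules (a join with
   numDomainType is missing from the library); the instances below equip the
   carrier with both. *)
Record cstarAlgType (R : realType) : Type := CStarAlgType {
  cstar_base : completeNormedModType R[i];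
  cstar_one : cstar_base;
  cstar_mul : cstar_base -> cstar_base -> cstar_base;
  cstar_star : cstar_base -> cstar_base;
  cstar_mulA : associative cstar_mul;
  cstar_mul1 : left_id cstar_one cstar_mul;
  cstar_mulr1 : right_id cstar_one cstar_mul;
  cstar_mulDl : left_distributive cstar_mul +%R;
  cstar_mulDr : right_distributive cstar_mul +%R;
  cstar_one_neq0 : cstar_one != 0;
  cstar_scaleAl : forall (l : R[i]) (x y : cstar_base),
    l *: cstar_mul x y = cstar_mul (l *: x) y;
  cstar_scaleAr : forall (l : R[i]) (x y : cstar_base),
    l *: cstar_mul x y = cstar_mul x (l *: y);
  cstar_starK : involutive cstar_star;
  cstar_starD : {morph cstar_star : x y / x + y};
  cstar_starZ : forall (l : R[i]) (x : cstar_base),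
    cstar_star (l *: x) = (l^*)%R *: cstar_star x;
  cstar_starM : forall x y : cstar_base,
    cstar_star (cstar_mul x y) = cstar_mul (cstar_star y) (cstar_star x);
  cstar_normM : forall x y : cstar_base, `|cstar_mul x y| <= `|x| * `|y|;
  cstar_normE : forall x : cstar_base,
    `|cstar_mul (cstar_star x) x| = `|x| ^+ 2
}.

Definition cstar_sort (R : realType) (A : cstarAlgType R) : Type :=
  cstar_base A.
Coercion cstar_sort : cstarAlgType >-> Sortclass.

Section CStarAlgebraInstances.
Context (R : realType) (A : cstarAlgType R).

HB.instance Definition _ :=
  CompleteNormedModule.copy (cstar_sort A) (cstar_base A).
HB.instance Definition _ :=
  GRing.Zmodule_isNzRing.Build (cstar_sort A)
    (@cstar_mulA R A) (@cstar_mul1 R A) (@cstar_mulr1 R A)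
    (@cstar_mulDl R A) (@cstar_mulDr R A) (cstar_one_neq0 A).
HB.instance Definition _ :=
  GRing.Lmodule_isLalgebra.Build R[i] (cstar_sort A) (@cstar_scaleAl R A).
HB.instance Definition _ :=
  GRing.Lalgebra_isAlgebra.Build R[i] (cstar_sort A) (@cstar_scaleAr R A).

Definition star (x : A) : A := cstar_star x.

End CStarAlgebraInstances.

Section CStarAlgebraTheory.
Context {R : realType} {A : cstarAlgType R}.
Implicit Types (B D H I : set A) (a b x y p : A).

Definition invertible x := exists y, y * x = 1 /\ x * y = 1.

Definition spectrum a : set R[i] := [set l | ~ invertible (l%:A - a)].

(* In the order of R[i], [0 <= l] says that l is real and nonnegative. *)
Definition positive a :=
  star a = a /\ forall l : R[i], spectrum a l -> 0 <= l.

Definition cstar_le a b := positive (b - a).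

Definition projection p := star p = p /\ p * p = p.

(* [D] need not contain the unit of [A]. *)
Record is_subCStar D : Prop := IsSubCStar {
  subCStar0 : D 0;
  subCStarD : forall x y, D x -> D y -> D (x + y);
  subCStarZ : forall (l : R[i]) x, D x -> D (l *: x);
  subCStarM : forall x y, D x -> D y -> D (x * y);
  subCStar_star : forall x, D x -> D (star x);
  subCStar_closed : closed D
}.

Record is_closed_ideal D I : Prop := IsClosedIdeal {
  closed_ideal_sub : I `<=` D;
  closed_ideal0 : I 0;
  closed_idealD : forall x y, I x -> I y -> I (x + y);
  closed_idealZ : forall (l : R[i]) x, I x -> I (l *: x);
  closed_idealMl : forall x y, D x -> I y -> I (x * y);
  closed_idealMr : forall x y, I x -> D y -> I (x * y);
  closed_ideal_closed : closed I
}.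

Definition simple_cstar D :=
  D <> [set 0] /\ forall I, is_closed_ideal D I -> I = [set 0] \/ I = D.

Definition unital_inclusion B := is_subCStar B /\ B 1.

Definition cstar_irreducible B :=
  forall D, is_subCStar D -> B `<=` D -> simple_cstar D.

Definition full_relatively B a :=
  exists (n : nat) (x : 'I_n -> A), (forall j, B (x j)) /\
    cstar_le 1 (\sum_(j < n) star (x j) * a * x j).

Definition hereditary H :=
  is_subCStar H /\
  forall a b, positive a -> cstar_le a b -> H b -> H a.

End CStarAlgebraTheory.

Definition property_SP (R : realType) (A : cstarAlgType R) :=
  forall H : set A, hereditary H -> H <> [set 0] ->
    exists p : A, [/\ H p, projection p & p <> 0].

(* Main.v *)
(* Fix a nonzero positive [a], and let [K] be the cone of the sums of
   [z^* a z] with [z] in [B]; [a] is full when some element of [K] dominates 1.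
   Let [H] be the set of all [x] such that [x^* x] and [x x^*] are dominated by
   elements of [K] up to any [e > 0]. It is a hereditary subalgebra of [A], it
   contains [a], and [B H] and [H B] are contained in [H]. So [H] is a closed
   ideal of its idealizer, which is an intermediate algebra: if the inclusion
   is irreducible, then 1 lies in [H] and [a] is full. Under (SP), [H] contains
   a nonzero projection [p], and if [p] is full so is [a], as [p = p^* p].
   Conversely, a nonzero ideal [I] of an intermediate algebra contains a
   nonzero [x^* x], hence, by fullness, some [S >= 1]; a Neumann series inverts
   [S] in the intermediate algebra, so 1 lies in [I].

   The order on [A] is built without Gelfand theory: square roots and inverses
   come from the Banach fixed point theorem, and [x^* x >= 0] from polynomials
   in [x^* x]. *)

Require Import Defs.
From mathcomp Require Import all_boot all_order all_algebra.
From mathcomp Require Import complex ring lra.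
From mathcomp Require Import all_classical all_reals all_analysis.

Set Implicit Arguments.
Unset Strict Implicit.
Unset Printing Implicit Defensive.

Import Order.TTheory GRing.Theory Num.Theory.
Import numFieldNormedType.Exports.

Local Open Scope classical_set_scope.
Local Open Scope ring_scope.
Local Open Scope complex_scope.

Section CStarAlgebra.
Context {R : realType} {A : cstarAlgType R}.
Implicit Types (x y z a b c d h p q S T : A) (B D I : set A).

(** * Real-valued norm and involution *)

Definition nrm x : R := complex.Re `|x|.

Lemma normE x : `|x| = (nrm x)%:C.
Proof. exact/esym/RRe_real/normr_real. Qed.

Lemma nrm_ge0 x : 0 <= nrm x.
Proof. rewrite -lecR -normE; exact: normr_ge0. Qed.

Lemma nrmD x y : nrm (x + y) <= nrm x + nrm y.
Proof. by rewrite -lecR rmorphD /= -!normE ler_normD. Qed.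

Lemma nrmN x : nrm (- x) = nrm x.
Proof. by rewrite /nrm normrN. Qed.

Lemma nrmB x y : nrm (x - y) <= nrm x + nrm y.
Proof. by rewrite -(nrmN y) nrmD. Qed.

Lemma nrmC x y : nrm (x - y) = nrm (y - x).
Proof. by rewrite -nrmN opprB. Qed.

Lemma nrmM x y : nrm (x * y) <= nrm x * nrm y.
Proof. by rewrite -lecR rmorphM /= -!normE; exact: cstar_normM. Qed.

Lemma nrmZ (l : R[i]) x : nrm (l *: x) = complex.Re `|l| * nrm x.
Proof.
apply: complexI; rewrite rmorphM /= -!normE normrZ.
by rewrite (RRe_real (normr_real l)).
Qed.

Lemma nrmZr (r : R) x : nrm (r%:C *: x) = `|r| * nrm x.
Proof. by rewrite nrmZ normc_def /= expr0n /= addr0 sqrtr_sqr. Qed.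

Lemma nrm_eq0 x : nrm x = 0 -> x = 0.
Proof. by move=> x0; apply/normr0_eq0; rewrite normE x0. Qed.

Lemma nrm0 : nrm 0 = 0.
Proof. by rewrite /nrm normr0. Qed.

Lemma nrm_gt0 x : x <> 0 -> 0 < nrm x.
Proof. by move=> x0; rewrite lt0r nrm_ge0 andbT; apply/eqP => /nrm_eq0. Qed.

Lemma nrmE x : nrm (star x * x) = nrm x ^+ 2.
Proof. by apply: complexI; rewrite rmorphXn /= -!normE; exact: cstar_normE. Qed.

Lemma starK x : star (star x) = x. Proof. exact: cstar_starK. Qed.

Lemma starD x y : star (x + y) = star x + star y.
Proof. exact: cstar_starD. Qed.

Lemma starZ (l : R[i]) x : star (l *: x) = (l^*)%R *: star x.
Proof. exact: cstar_starZ. Qed.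

Lemma starZr (r : R) x : star (r%:C *: x) = r%:C *: star x.
Proof. by rewrite starZ conj_Creal // complex_real. Qed.

Lemma starM x y : star (x * y) = star y * star x.
Proof. exact: cstar_starM. Qed.

Lemma star0 : star (0 : A) = 0.
Proof. by apply: (addrI (star 0)); rewrite -starD !addr0. Qed.

Lemma starN x : star (- x) = - star x.
Proof. by apply: (addrI (star x)); rewrite -starD !subrr star0. Qed.

Lemma starB x y : star (x - y) = star x - star y.
Proof. by rewrite starD starN. Qed.

Lemma star1 : star (1 : A) = 1.
Proof. by rewrite -[LHS]mulr1 -[X in _ * X]starK -starM mulr1 starK. Qed.

Lemma star_real (r : R) : star (r%:C%:A : A) = r%:C%:A.
Proof. by rewrite starZr star1. Qed.

Lemma starX x n : star (x ^+ n) = star x ^+ n.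
Proof. by elim: n => [|n IH]; rewrite ?expr0 ?star1 // exprS starM IH exprSr. Qed.

(** The C*-identity gives [|y|^2 = |y^* y| <= |y^*| |y|]; cancel [|y|], then apply the same bound to
    [y^*]. *)
Lemma nrm_star x : nrm (star x) = nrm x.
Proof.
suff H y : nrm y <= nrm (star y).
  by apply/eqP; rewrite eq_le H andbT -{2}[x]starK H.
have := nrm_ge0 y; rewrite le_eqVlt => /orP[/eqP<-|y0]; first exact: nrm_ge0.
by rewrite -(ler_pM2r y0) -expr2 -nrmE nrmM.
Qed.

Lemma nrm1 : nrm (1 : A) = 1.
Proof.
have n0 : 0 < nrm (1 : A) by apply/nrm_gt0/eqP/oner_neq0.
have := nrmE 1; rewrite star1 mul1r expr2 -[LHS]mulr1.
by move/(mulfI (lt0r_neq0 n0)) => <-.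
Qed.

Lemma nrm_real (r : R) : nrm (r%:C%:A : A) = `|r|.
Proof. by rewrite nrmZr nrm1 mulr1. Qed.

(** * Completeness and the contraction principle *)

Lemma closed_nrmP D :
  closed D <-> forall x, (forall e : R, 0 < e -> exists2 y, D y & nrm (x - y) < e) -> D x.
Proof.
split=> [cD x H|H].
  apply: cD => B; rewrite -nbhs_ballE => -[e /= e0 eB].
  have [/eqP eI eR] : complex.Im e == 0 /\ 0 < complex.Re e.
    by move: e0; rewrite ltcE => /andP[].
  have [y Dy xy] := H _ eR; exists y; split=> //; apply: eB.
  rewrite -ball_normE /ball_ /= normE ltcE /= eI eqxx /=; exact: xy.
move=> x cx; apply: H => e e0.
have /cx[y [Dy]] : nbhs x (ball x e%:C) by apply: nbhsx_ballx; rewrite ltcR.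
rewrite -ball_normE /ball_ /= normE ltcR => xy.
by exists y.
Qed.

Lemma geometric_cvg (u : nat -> A) (r C : R) : 0 <= r < 1 ->
    (forall n, nrm (u n.+1 - u n) <= C * r ^+ n) ->
  exists l, forall e : R, 0 < e -> exists N, forall n, (N <= n)%N -> nrm (l - u n) < e.
Proof.
move=> /andP[r0 r1] uC.
have r1' : 0 < 1 - r by rewrite subr_gt0.
have C0 : 0 <= C.
  by have := uC 0%N; rewrite expr0 mulr1; apply: le_trans; exact: nrm_ge0.
(* The factor [1 - r ^+ k] records the exact partial geometric sum, so that the induction on [k]
   closes. *)
have tel N k : nrm (u (N + k)%N - u N) <= C * r ^+ N / (1 - r) * (1 - r ^+ k).
  elim: k => [|k IH]; first by rewrite addn0 subrr nrm0 expr0 subrr mulr0.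
  rewrite addnS -(subrKA (u (N + k)%N)); apply: (le_trans (nrmD _ _)).
  apply: (le_trans (lerD (uC _) IH)); rewrite exprD exprS le_eqVlt; apply/orP; left.
  by apply/eqP; field; rewrite lt0r_neq0.
have tel' N n : (N <= n)%N -> nrm (u n - u N) <= C * r ^+ N / (1 - r).
  move=> Nn; rewrite -(subnKC Nn); apply: (le_trans (tel _ _)).
  rewrite ler_piMr ?divr_ge0 ?mulr_ge0 ?exprn_ge0 ?(ltW r1') //.
  by rewrite lerBlDr lerDl exprn_ge0.
have small (e : R) : 0 < e -> exists N, C * r ^+ N / (1 - r) < e.
  move=> e0; have e1 : 0 < e * (1 - r) / (C + 1).
    by rewrite !mulr_gt0 // invr_gt0 ltr_wpDl.
  have /cvgrPdist_lt/(_ _ e1)[N _ HN] : (fun n => r ^+ n) @ \oo --> (0 : R).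
    by apply: cvg_expr; rewrite ger0_norm.
  exists N; have := HN N (leqnn N); rewrite /= sub0r normrN ger0_norm ?exprn_ge0 //.
  rewrite ltr_pdivrMr // ltr_pdivlMr ?ltr_wpDl // => lt.
  apply: le_lt_trans lt; rewrite mulrC ler_wpM2l ?exprn_ge0 //.
  by rewrite lerDl.
have /cauchy_cvgP : cauchy (u @ \oo).
  apply: cauchy_exP => e e0.
  have [/eqP eI eR] : complex.Im e == 0 /\ 0 < complex.Re e.
    by move: e0; rewrite ltcE => /andP[].
  have [N HN] := small _ eR.
  exists (u N); exists N => // n /= Nn; rewrite -ball_normE /ball_ /= normE ltcE /= eI.
  by rewrite eqxx /= nrmC; apply: le_lt_trans HN; exact: tel'.
move=> /cvg_ex[/= l ul]; exists l => e e0.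
have e0' : 0 < e%:C by rewrite ltcR.
move/cvgrPdist_lt : ul => /(_ _ e0')[N _ HN]; exists N => n Nn.
by have := HN n Nn; rewrite /= normE ltcR.
Qed.

(** The invariant closed set [D] lets the fixed point inherit further properties: membership in a
    subalgebra, self-adjointness, commutation relations. *)
Lemma banach_fixpoint D (f : A -> A) (r : R) :
  closed D -> 0 <= r < 1 -> (exists y, D y) -> (forall y, D y -> D (f y)) ->
  (forall y z, D y -> D z -> nrm (f y - f z) <= r * nrm (y - z)) ->
  exists2 y, D y & f y = y.
Proof.
move=> /closed_nrmP cD r01 [y0 Dy0] fD fr.
have /andP[r0 r1] := r01.
pose u n := iter n f y0.
have Du n : D (u n) by elim: n => // n; exact: fD.
have [|l ul] := @geometric_cvg u r (nrm (f y0 - y0)) r01.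
  elim=> [|n IH]; first by rewrite expr0 mulr1.
  apply: le_trans (fr _ _ (Du n.+1) (Du n)) _.
  by rewrite exprS mulrCA ler_wpM2l.
have Dl : D l by apply: cD => e /ul[N /(_ N (leqnn N))]; exists (u N).
exists l => //; apply/subr0_eq/nrm_eq0/eqP; rewrite eq_le nrm_ge0 andbT.
apply/ler_addgt0Pr => e e0; rewrite add0r.
have e2 : 0 < e / 2 by rewrite divr_gt0.
have [N HN] := ul _ e2.
rewrite -(subrKA (u N.+1)); apply: (le_trans (nrmD _ _)).
have h1 := fr _ _ Dl (Du N); have h2 := HN _ (leqnSn N); have h3 := HN _ (leqnn N).
rewrite [X in _ + X]nrmC; have := nrm_ge0 (l - u N).
change (f (u N)) with (u N.+1) in h1; nra.
Qed.

Lemma nrm_small x (K : R) : (forall e : R, 0 < e -> nrm x <= K * e) -> x = 0.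
Proof.
move=> H; apply: nrm_eq0; apply/eqP; rewrite eq_le nrm_ge0 andbT.
apply/ler_addgt0Pr => e e0; rewrite add0r.
have K1 : 0 < `|K| + 1 by rewrite ltr_wpDl.
apply: le_trans (H (e / (`|K| + 1)) (divr_gt0 e0 K1)) _.
rewrite mulrCA ger_pMr // ler_pdivrMr // mul1r.
by apply: le_trans (ler_norm K) _; rewrite lerDl.
Qed.

(** * Neumann series and invertibility *)

Lemma is_subCStarT : is_subCStar [set: A].
Proof. by split => //; exact: closedT. Qed.

Lemma subCStarB D x y : is_subCStar D -> D x -> D y -> D (x - y).
Proof.
by move=> sD Dx Dy; rewrite -scaleN1r; apply: subCStarD => //; exact: subCStarZ.
Qed.

(** The fixed points of [y |-> 1 + y x] and [y |-> 1 + x y] in [D] are a left and a right inverse of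
    [1 - x], hence equal. *)
Lemma neumann D x : is_subCStar D -> D 1 -> D x -> nrm x < 1 ->
  exists y, [/\ D y, y * (1 - x) = 1 & (1 - x) * y = 1].
Proof.
move=> sD D1 Dx x1; have cD := subCStar_closed sD.
have r01 : 0 <= nrm x < 1 by rewrite nrm_ge0.
have [||y z _ _|y Dy fy] := @banach_fixpoint D (fun y => 1 + y * x) (nrm x) cD r01.
- by exists 1.
- by move=> y Dy; apply: (subCStarD sD) => //; exact: subCStarM.
- by rewrite opprD addrACA subrr add0r -mulrBl [X in _ <= X]mulrC nrmM.
have [||y' z _ _|y' Dy' fy'] := @banach_fixpoint D (fun y => 1 + x * y) (nrm x) cD r01.
- by exists 1.
- by move=> z Dz; apply: (subCStarD sD) => //; exact: subCStarM.
- by rewrite opprD addrACA subrr add0r -mulrBr nrmM.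
have yl : y * (1 - x) = 1 by rewrite mulrBr mulr1 -{1}fy addrK.
have yr : (1 - x) * y' = 1 by rewrite mulrBl mul1r -{1}fy' addrK.
exists y; split=> //.
by rewrite -[y]mulr1 -yr (mulrA y) yl mul1r yr.
Qed.

Lemma invertible_1B x : nrm x < 1 -> invertible (1 - x).
Proof. by move=> /(neumann is_subCStarT I I)[y [_ yl yr]]; exists y. Qed.

Lemma invertibleM x y : invertible x -> invertible y -> invertible (x * y).
Proof.
move=> [x' [xl xr]] [y' [yl yr]]; exists (y' * x'); split.
  by rewrite mulrA -(mulrA y') xl mulr1.
by rewrite mulrA -(mulrA x) yr mulr1.
Qed.

Lemma invertibleZ (l : R[i]) x : l != 0 -> invertible x -> invertible (l *: x).
Proof.
move=> l0 [y [yl yr]]; exists (l^-1 *: y).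
by rewrite -!scalerAl -!scalerAr !scalerA mulVf // mulfV // yl yr scale1r.
Qed.

Lemma invertibleN x : invertible (- x) <-> invertible x.
Proof.
suff H y : invertible y -> invertible (- y) by split=> /H; rewrite ?opprK.
by move=> [z [zl zr]]; exists (- z); rewrite !mulrNN.
Qed.

(** If [z] inverts [x y = y x], then [z y] is a left inverse of [x] and [y z] a right one, so they
    agree. *)
Lemma invertible_commM x y : x * y = y * x -> invertible (x * y) -> invertible x.
Proof.
move=> xy [z [zl zr]]; exists (z * y); split; first by rewrite -mulrA -xy.
suff -> : z * y = y * z by rewrite mulrA.
by rewrite -[LHS]mulr1 -zr !mulrA -(mulrA z y x) -xy zl mul1r.
Qed.

(** * Spectrum and norm of self-adjoint elements; square roots *)

Lemma spectrum_nrm a (l : R[i]) : spectrum a l -> complex.Re `|l| <= nrm a.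
Proof.
move=> sl; rewrite leNgt; apply/negP => al; apply: sl.
have l0 : l != 0.
  by apply: contraTneq al => ->; rewrite normr0 -leNgt nrm_ge0.
have -> : l%:A - a = l *: (1 - l^-1 *: a).
  by rewrite scalerBr scalerA divff // scale1r.
apply/invertibleZ/invertible_1B => //.
rewrite nrmZ normfV.
have nl : (complex.Re `|l|)%:C = `|l| by exact/RRe_real/normr_real.
have l1 : 0 < complex.Re `|l| by apply: le_lt_trans al; exact: nrm_ge0.
by rewrite -nl -fmorphV /= mulrC ltr_pdivrMr // mul1r.
Qed.

Lemma spectrum_subr a (c l : R[i]) : spectrum (c%:A - a) l -> spectrum a (c - l).
Proof.
rewrite /spectrum /= => H /invertibleN => H'; apply: H.
by move: H'; rewrite scalerBl !opprB addrCA addrA.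
Qed.

(* Arens' trick: [l + i t] is in the spectrum of [h + i t], whose norm is at
   most [(|h|^2 + t^2)^(1/2)], for every real [t]. *)
Lemma spectrum_real h (l : R[i]) : star h = h -> spectrum h l -> l = (complex.Re l)%:C.
Proof.
case: l => u v hh sl /=; congr Complex; apply/eqP; apply: contraT => v0.
have bnd (t : R) : u ^+ 2 + (v + t) ^+ 2 <= nrm h ^+ 2 + t ^+ 2.
  pose k := h + (0 +i* t)%:A.
  have /spectrum_nrm H : spectrum k ((u +i* v) + (0 +i* t)).
    by rewrite /spectrum /= scalerDl opprD addrACA subrr addr0.
  have : complex.Re `|(u +i* v) + (0 +i* t)| ^+ 2 <= nrm k ^+ 2.
    by rewrite lerXn2r ?nnegrE ?nrm_ge0 // normc_def /= sqrtr_ge0.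
  rewrite normc_def /= sqr_sqrtr ?addr_ge0 ?sqr_ge0 // addr0 => /le_trans; apply.
  rewrite -nrmE /k starD starZ star1 hh.
  have -> : (h + ((0 +i* t)^*)%R%:A) * (h + (0 +i* t)%:A) = h * h + (t ^+ 2)%:C%:A.
    rewrite mulrDr !mulrDl -!scalerAr -!scalerAl !mulr1 !mul1r !scalerA.
    rewrite -addrA; congr (_ + _); rewrite addrA -scalerDl.
    rewrite (_ : (0 +i* t)^*%R = (0 -i* t)) //.
    have -> : (0 -i* t) + (0 +i* t) = 0 by apply/eqP; rewrite eq_complex /= addNr addr0 eqxx.
    rewrite scale0r add0r.
    congr (_ *: _); apply/eqP; rewrite eq_complex /=; apply/andP; split; apply/eqP; ring.
  apply: le_trans (nrmD _ _) _; rewrite nrm_real ger0_norm ?sqr_ge0 // lerD2r.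
  by rewrite expr2; exact: nrmM.
(* This value of [t] makes the cross term [2 v t] equal to [|h|^2 + 1], more than [bnd] allows. *)
have := bnd ((nrm h ^+ 2 + 1) / (2 * v)).
rewrite sqrrD addrA addrA lerD2r.
have -> : v * ((nrm h ^+ 2 + 1) / (2 * v)) *+ 2 = nrm h ^+ 2 + 1.
  by rewrite -mulr_natr; field.
have := sqr_ge0 u; have := sqr_ge0 v; lra.
Qed.

(* For [s = 1], [q = 1 - y] where [y] is the fixed point of [y |-> (x + y^2) / 2]. *)
Lemma sqrt_subr x (s : R) : star x = x -> nrm x < s ->
  exists q, [/\ star q = q, q * q = s%:C%:A - x & forall z, z * x = x * z -> z * q = q * z].
Proof.
wlog -> : x s / s = 1.
  move=> H xx xs; have s0 : 0 < s by apply: le_lt_trans xs; exact: nrm_ge0.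
  have [||q [qq q2 qz]] := H (s^-1%:C *: x) 1 erefl.
  - by rewrite starZr xx.
  - by rewrite nrmZr ger0_norm ?invr_ge0 ?ltW // mulrC ltr_pdivrMr // mul1r.
  exists ((Num.sqrt s)%:C *: q); split; first by rewrite starZr qq.
  - rewrite -scalerAl -scalerAr scalerA q2 -rmorphM /= -expr2 sqr_sqrtr ?(ltW s0) //.
    by rewrite scalerBr !scalerA -!rmorphM /= mulr1 divff ?lt0r_neq0 // scale1r.
  - by move=> z zx; rewrite -scalerAl -scalerAr qz // -scalerAl -scalerAr zx.
move=> xx x1.
(* On [D] the map [y |-> (x + y^2) / 2] contracts with ratio [|x| < 1], since
   [y^2 - z^2 = y (y - z) + (y - z) z]; it preserves [D] because [(|x| + |x|^2) / 2 <= |x|]. *)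
pose D := [set y | [/\ star y = y, nrm y <= nrm x & forall z, z * x = x * z -> z * y = y * z]].
have cD : closed D.
  apply/closed_nrmP => y H; split.
  - apply/subr0_eq/(@nrm_small _ 2) => e /H[z [zz _ _] yz].
    have -> : star y - y = star (y - z) - (y - z) by rewrite starB zz opprB addrA subrK.
    by apply: le_trans (nrmB _ _) _; rewrite nrm_star; lra.
  - apply/ler_addgt0Pr => e /H[z [_ zx _] yz]; rewrite -(subrK z y) addrC.
    by apply: le_trans (nrmD _ _) _; rewrite lerD // ltW.
  - move=> z zx; apply/subr0_eq/(@nrm_small _ (2 * nrm z)) => e /H[t [_ _ tx] yt].
    have -> : z * y - y * z = z * (y - t) - (y - t) * z.
      by rewrite mulrBr mulrBl tx // opprB addrA subrK.
    apply: le_trans (nrmB _ _) _.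
    have := nrmM z (y - t); have := nrmM (y - t) z.
    have := nrm_ge0 z; nra.
have r01 : 0 <= nrm x < 1 by rewrite nrm_ge0.
have [||y z [yy yx yc] [zz zx zc]|y [yy _ yz] fy] :=
  @banach_fixpoint D (fun y => 2^-1%:C *: (x + y * y)) (nrm x) cD r01.
- by exists 0; split; rewrite ?star0 ?nrm0 ?nrm_ge0 // => z _; rewrite mulr0 mul0r.
- move=> y [yy yx yc]; split.
  + by rewrite starZr starD starM xx yy.
  + rewrite nrmZr ger0_norm ?invr_ge0 //; have := nrmD x (y * y); have := nrmM y y.
    have := nrm_ge0 y; nra.
  + move=> z zx; rewrite -scalerAl -scalerAr mulrDr mulrDl zx.
    by rewrite mulrA (yc z zx) -(mulrA y z) (yc z zx) (mulrA y y).
- rewrite -scalerBr nrmZr ger0_norm ?invr_ge0 //.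
  rewrite opprD addrACA subrr add0r.
  have -> : y * y - z * z = y * (y - z) + (y - z) * z.
    by rewrite mulrBr mulrBl addrA subrK.
  have := nrmD (y * (y - z)) ((y - z) * z).
  have := nrmM y (y - z); have := nrmM (y - z) z; have := nrm_ge0 (y - z).
  nra.
exists (1 - y); split; first by rewrite starB star1 yy.
- have fy' : x + y * y = y + y.
    rewrite -{3 4}fy /= -scalerDl -rmorphD /= (_ : 2^-1 + 2^-1 = 1) ?scale1r //; lra.
  have -> : x = y + y - y * y by rewrite -fy' addrK.
  by rewrite mulrBr mulr1 mulrBl mul1r scale1r -addrA -opprD addrA.
- by move=> z zx; rewrite mulrBr mulrBl mulr1 mul1r yz.
Qed.

(* If [r] inverts [1 - a^2], then for a small [d > 0] there are commuting
   self-adjoint [q, w] with [q^2 = 1 + d/2 - a^2] and [w^2 = 1 - d r]. Then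
   [u = a + i q w] has [u^* u = 1 - d/2 - (d^2/2) r], so [|a| <= |u| < 1]. *)
Lemma not_invertible_1Bsqr a : star a = a -> nrm a = 1 -> ~ invertible (1 - a * a).
Proof.
move=> aa a1 [r [rl rr]].
have ar : a * r = r * a.
  rewrite -[LHS]mul1r -rl -!mulrA (mulrA _ a r).
  rewrite (_ : (1 - a * a) * a = a * (1 - a * a)).
    by rewrite -(mulrA a) rr mulr1.
  by rewrite mulrBl mulrBr mul1r mulr1 mulrA.
have sr : star r = r.
  have : star r * (1 - a * a) = 1.
    by have := congr1 (@star R A) rr; rewrite starM starB starM aa star1.
  by move=> srl; rewrite -[LHS]mulr1 -rr mulrA srl mul1r.
(* This choice gives [d <= 1/2] and [d |r| < 1/2]: the latter provides the root [w] and makes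
   [|u| < 1] below. *)
pose d := (2 * (nrm r + 1))^-1.
have N0 := nrm_ge0 r.
have d0 : 0 < d by rewrite invr_gt0; lra.
have dr : d * nrm r < 2^-1.
  by rewrite mulrC ltr_pdivrMr; lra.
have [||q [qq q2 qz]] := @sqrt_subr (a * a) (1 + d / 2).
- by rewrite starM aa.
- have := nrmM a a; rewrite a1; lra.
have [||w [ww w2 wz]] := @sqrt_subr (d%:C *: r) 1.
- by rewrite starZr sr.
- rewrite nrmZr gtr0_norm //; lra.
have aw : a * w = w * a by apply: wz; rewrite -scalerAl -scalerAr ar.
have aq : a * q = q * a by apply: qz; rewrite mulrA.
have qw : q * w = w * q by apply/esym/qz; rewrite mulrA -aw -mulrA -aw mulrA.
pose v := q * w.
have sv : star v = v by rewrite /v starM qq ww qw.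
have av : a * v = v * a by rewrite /v mulrA aq -mulrA aw mulrA.
have a2r : a * a * r = r - 1 by rewrite -rr mulrBl mul1r subKr.
have v2 : v * v = (1 + d / 2 - d)%:C%:A - a * a - (d / 2 * d)%:C *: r.
  rewrite /v mulrA -(mulrA q w q) -qw mulrA q2 -mulrA w2.
  rewrite mulrBr scale1r mulr1 -scalerAr mulrBl mulr_algl a2r opprB.
  have -> : (d / 2 * d)%:C = (d * (1 + d / 2))%:C - d%:C.
    by rewrite -rmorphB /=; congr (_%:C); field.
  rewrite rmorphB /= !(scalerBl, scalerDr, scalerN) scalerA -rmorphM /=.
  rewrite !(opprB, opprD, opprK) !addrA.
  by rewrite [LHS](ACl (1 * 5 * 2 * 4 * 3)).
pose u := a + 'i%C *: v.
have su : star u = a - 'i%C *: v.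
  rewrite starD aa starZ sv; congr (_ + _); rewrite -scaleNr; congr (_ *: _).
  by apply/eqP; rewrite eq_complex /= oppr0 !eqxx.
have uu : star u * u = (1 + d / 2 - d)%:C%:A - (d / 2 * d)%:C *: r.
  rewrite su /u mulrBl !mulrDr opprD addrA.
  rewrite -(scalerAl _ v a) -(scalerAr _ a v) -(scalerAl _ v) -(scalerAr _ v v) av.
  rewrite addrK scalerA -['i%C * _]expr2 sqr_i scaleN1r opprK v2.
  by rewrite addrC addrAC subrK.
have : nrm u ^+ 2 < 1.
  rewrite -nrmE uu; apply: le_lt_trans (nrmB _ _) _.
  rewrite nrm_real nrmZr.
  have d1 : d <= 2^-1 by rewrite lef_pV2 ?posrE; lra.
  rewrite ger0_norm; last lra.
  rewrite ger0_norm; nra.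
move=> u1; have {}u1 : nrm u < 1 by have := nrm_ge0 u; nra.
(* As [2 a = u + u^*], this yields [2 = 2 |a| <= 2 |u| < 2]. *)
have : nrm (u + star u) <= nrm u + nrm u by apply: le_trans (nrmD _ _) _; rewrite nrm_star.
rewrite su /u addrACA subrr addr0.
have -> : a + a = 2%:C *: a by rewrite [2%:C]rmorphD /= scalerDl !scale1r.
by rewrite nrmZr a1 ger0_norm //; lra.
Qed.

(** The norm of a self-adjoint element is attained on its spectrum: for [b = a / |a|], if neither
    [|a|] nor [- |a|] were in the spectrum of [a], then [1 - b^2 = (1 - b)(1 + b)] would be
    invertible. *)
Lemma selfadj_nrm_le a (r : R) : star a = a -> 0 <= r ->
  (forall t : R, spectrum a t%:C -> `|t| <= r) -> nrm a <= r.
Proof.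
move=> aa r0 H; rewrite leNgt; apply/negP => ra.
have n0 : 0 < nrm a by apply: le_lt_trans ra.
pose b := (nrm a)^-1%:C *: a.
have ni0 : (nrm a)^-1%:C != 0 :> R[i] by rewrite fmorph_eq0 invr_eq0 lt0r_neq0.
have nn : nrm a * (nrm a)^-1 = 1 by rewrite divff // lt0r_neq0.
have sb : star b = b by rewrite starZr aa.
have nb : nrm b = 1 by rewrite nrmZr ger0_norm ?invr_ge0 ?nrm_ge0 // mulrC.
apply: (not_invertible_1Bsqr sb nb).
have -> : 1 - b * b = (1 - b) * (1 + b).
  by rewrite mulrBl !mulrDr !mulr1 mul1r opprD addrA addrK.
have nsp (t : R) : `|t| = nrm a -> invertible (t%:C%:A - a).
  by move=> ta; apply: contrapT => /H; rewrite ta leNgt ra.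
apply: invertibleM.
  have -> : 1 - b = (nrm a)^-1%:C *: ((nrm a)%:C%:A - a).
    by rewrite scalerBr scalerA -rmorphM /= mulrC nn scale1r.
  by apply/invertibleZ/nsp => //; rewrite ger0_norm // ltW.
have -> : 1 + b = - ((nrm a)^-1%:C *: ((- nrm a)%:C%:A - a)).
  by rewrite scalerBr scalerA -rmorphM /= mulrN mulrC nn opprB rmorphN scaleN1r opprK addrC.
apply/invertibleN/invertibleZ/nsp => //; rewrite normrN ger0_norm // ltW //.
Qed.

(** * The cone of positive elements *)

Lemma positiveP a :
  positive a <-> star a = a /\ forall t : R, spectrum a t%:C -> 0 <= t.
Proof.
split=> -[aa H]; split=> // t; first by move/H; rewrite lecR.
by move=> st; have tE := spectrum_real aa st; move: st; rewrite tE => /H; rewrite lecR.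
Qed.

(** A point [t] of the spectrum of [s - a] has [0 <= s - t <= |a| <= s]. With the converse
    [nrm_positive], this is a norm criterion for positivity, which reduces sums of positive elements
    to the triangle inequality. *)
Lemma positive_nrm a (s : R) : positive a -> nrm a <= s -> nrm (s%:C%:A - a) <= s.
Proof.
move=> /positiveP[aa H] as_; apply: selfadj_nrm_le.
- by rewrite starB star_real aa.
- by apply: le_trans as_; exact: nrm_ge0.
move=> t /spectrum_subr; rewrite -rmorphB /= => st.
have t0 := H _ st.
have := spectrum_nrm st; rewrite normc_def /= expr0n addr0 sqrtr_sqr ger0_norm // => t1.
rewrite ler_norml; lra.
Qed.

Lemma nrm_positive a (s : R) : star a = a -> nrm (s%:C%:A - a) <= s -> positive a.
Proof.
move=> aa H; apply/positiveP; split=> // t st.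
have : spectrum (s%:C%:A - a) (s - t)%:C.
  have E : (s - t)%:C%:A - (s%:C%:A - a) = - (t%:C%:A - a).
    by rewrite rmorphB /= scalerBl !opprB addrC addrA subrK.
  by rewrite /spectrum /= E => /invertibleN.
move=> /spectrum_nrm; rewrite normc_def /= expr0n addr0 sqrtr_sqr.
have := ler_norm (s - t); lra.
Qed.

Lemma positiveD a b : positive a -> positive b -> positive (a + b).
Proof.
move=> pa pb; apply: (@nrm_positive _ (nrm a + nrm b)).
  by rewrite starD pa.1 pb.1.
rewrite rmorphD /= scalerDl opprD addrACA.
by apply: le_trans (nrmD _ _) _; rewrite lerD // positive_nrm.
Qed.

Lemma positiveZ (r : R) a : 0 <= r -> positive a -> positive (r%:C *: a).
Proof.
move=> r0 pa; apply: (@nrm_positive _ (r * nrm a)).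
  by rewrite starZr pa.1.
rewrite rmorphM /= -scalerA -scalerBr nrmZr ger0_norm // ler_wpM2l //.
exact: positive_nrm.
Qed.

Lemma positive_selfadj a : star a = a -> positive ((nrm a)%:C%:A - a).
Proof.
move=> aa; apply: (@nrm_positive _ (nrm a)); first by rewrite starB star_real aa.
by rewrite subKr.
Qed.

Lemma positive_real (r : R) : 0 <= r -> positive (r%:C%:A : A).
Proof.
move=> r0; apply: (@nrm_positive _ r); first by rewrite star_real.
by rewrite subrr nrm0.
Qed.

Lemma positive0 : positive (0 : A).
Proof. by have := @positive_real 0 (lexx _); rewrite scale0r. Qed.

Lemma positive_lim a : (forall e : R, 0 < e -> positive (a + e%:C%:A)) -> positive a.
Proof.
move=> H; apply/positiveP; split.
  have /positiveP[+ _] := H 1 ltr01.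
  by rewrite starD star_real => /addIr.
move=> t st; apply/ler_addgt0Pr => e e0.
have /positiveP[_] := H e e0; apply.
by rewrite /spectrum /= rmorphD /= scalerDl opprD addrACA subrr addr0.
Qed.

(** * Spectral mapping for polynomials and positivity of [x^* x] *)

(** The polynomial [q - q(m)] is a multiple of [X - m], and [a - m] commutes with the cofactor; if
    the product were invertible, so would be [a - m]. *)
Lemma spectrum_horner_alg a (q : {poly R[i]}) (m : R[i]) :
  spectrum a m -> spectrum (horner_alg a q) q.[m].
Proof.
move=> sm; rewrite /spectrum /= => /invertibleN; rewrite opprB => H; apply: sm.
have /factor_theorem[p pE] : root (q - q.[m]%:P) m by rewrite /root !hornerE subrr.
have E : horner_alg a q - q.[m]%:A = horner_alg a p * (a - m%:A).
  by rewrite -(horner_algC a) -rmorphB /= pE rmorphM rmorphB /= horner_algX horner_algC.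
have E' : horner_alg a q - q.[m]%:A = (a - m%:A) * horner_alg a p.
  by rewrite -(horner_algC a) -rmorphB /= pE mulrC rmorphM rmorphB /= horner_algX horner_algC.
apply/invertibleN; rewrite opprB; apply: (@invertible_commM _ (horner_alg a p)).
  by rewrite -E -E'.
by rewrite -E'.
Qed.

(** Split [q - l] into linear factors over the algebraically closed field [R[i]]; if no root lay in
    the spectrum, each factor would be invertible at [a]. The bound on [size q] ensures
    [q - l != 0]. *)
Lemma horner_alg_spectrum a (q : {poly R[i]}) (l : R[i]) : (1 < size q)%N ->
  spectrum (horner_alg a q) l -> exists2 m, spectrum a m & l = q.[m].
Proof.
move=> q1 sl; pose p := q - l%:P.
have p0 : p != 0.
  rewrite subr_eq0; apply: contraTneq q1 => ->.
  by rewrite -leqNgt size_polyC leq_b1.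
have [rs pE] := closed_field_poly_normal p.
apply: contrapT => H; apply: sl.
have -> : l%:A - horner_alg a q = - horner_alg a p.
  by rewrite rmorphB /= horner_algC opprB.
apply/invertibleN; rewrite pE -mul_polyC rmorphM /= horner_algC mulr_algl.
apply: invertibleZ; first by rewrite lead_coef_eq0.
rewrite rmorph_prod /=.
have rsp (w : R[i]) : w \in rs -> root p w by rewrite pE rootZ ?lead_coef_eq0 // root_prod_XsubC.
elim: rs rsp {pE} => [|w rs IH] rsp.
  by rewrite big_nil; exists 1; rewrite mulr1.
rewrite big_cons; apply: invertibleM; last first.
  by apply: IH => w' w'rs; apply: rsp; rewrite in_cons w'rs orbT.
rewrite rmorphB /= horner_algX horner_algC; apply/invertibleN; rewrite opprB.
apply: contrapT => sz; apply: H; exists w => //.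
have := rsp w (mem_head _ _).
by rewrite /root !hornerE subr_eq0 => /eqP.
Qed.

(** If [z] inverts [l - y x], then [(1 + x z y) / l] inverts [l - x y]. *)
Lemma spectrum_mulC x y (l : R[i]) : l != 0 -> spectrum (x * y) l -> spectrum (y * x) l.
Proof.
move=> l0 sl [z [zl zr]]; apply: sl.
exists (l^-1 *: (1 + x * z * y)).
have E1 : x * z * y * (l%:A - x * y) = x * y.
  rewrite mulrBr mulr_algr.
  have -> : x * z * y * (x * y) = x * (z * (y * x)) * y by rewrite !mulrA.
  have -> : z * (y * x) = l *: z - 1.
    by rewrite -zl mulrBr mulr_algr subKr.
  by rewrite mulrBr mulrBl mulr1 -scalerAr -scalerAl subKr.
have E2 : (l%:A - x * y) * (x * z * y) = x * y.
  rewrite mulrBl mulr_algl.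
  have -> : x * y * (x * z * y) = x * (y * x * z) * y by rewrite !mulrA.
  have -> : y * x * z = l *: z - 1.
    by rewrite -zr mulrBl mulr_algl subKr.
  by rewrite mulrBr mulrBl mulr1 -scalerAr -scalerAl subKr.
split.
  by rewrite -scalerAl mulrDl mul1r E1 subrK scalerA mulVf // scale1r.
by rewrite -scalerAr mulrDr mulr1 E2 subrK scalerA mulVf // scale1r.
Qed.

Lemma positive_sqr h : star h = h -> positive (h * h).
Proof.
move=> hh; apply/positiveP; split; first by rewrite starM hh.
have E : h * h = horner_alg h ('X * 'X) by rewrite rmorphM /= horner_algX.
move=> t; rewrite E => /horner_alg_spectrum[|m sm].
  by rewrite -expr2 size_polyXn.
rewrite (spectrum_real hh sm) hornerM hornerX -rmorphM /= => -[->].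
exact: sqr_ge0.
Qed.

(** Up to scalars, [h] and [k] are the real and imaginary parts of [x]; the cross terms cancel in
    [h^2 + k^2]. *)
Lemma positive_star_commute x : positive (star x * x + x * star x).
Proof.
pose h := x + star x; pose k := 'i%C *: (x - star x).
have hh : star h = h by rewrite starD starK addrC.
have kk : star k = k.
  rewrite starZ starB starK.
  rewrite (_ : ('i%C^*)%R = - 'i%C); last by apply/eqP; rewrite eq_complex /= oppr0 !eqxx.
  by rewrite scaleNr -scalerN opprB.
have -> : star x * x + x * star x = 2^-1%:C *: (h * h + k * k).
  have -> : h * h + k * k = 2%:C *: (star x * x + x * star x).
    rewrite /h /k -scalerAl -scalerAr scalerA -['i%C * _]expr2 sqr_i scaleN1r.
    rewrite !(mulrDl, mulrDr, mulrN, mulNr) !(opprD, opprK) !addrA.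
    rewrite [2%:C]rmorphD /= scalerDl !scale1r.
    rewrite [LHS](ACl (3 * 2 * 7 * 6 * (1 * 5) * (4 * 8))) /=.
    by rewrite !subrr !addr0 !addrA.
  by rewrite scalerA -rmorphM /= mulVf ?scale1r.
by apply: positiveZ; rewrite ?invr_ge0 //; apply: positiveD; exact: positive_sqr.
Qed.

(** Bernoulli's inequality for [(1 + d / s)^n], multiplied by [s^(n+1)] to avoid division. *)
Lemma bernoulli_le (s d : R) n : 0 <= s -> 0 <= d ->
  s ^+ n * (s + n%:R * d) <= (s + d) ^+ n * s.
Proof.
move=> s0 d0; elim: n => [|n IH]; first by rewrite mul0r addr0.
have sn : 0 <= s ^+ n by rewrite exprn_ge0.
have n0 : 0 <= n%:R :> R by [].
rewrite !exprS -[X in _ <= X]mulrA.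
have : (s + d) * (s ^+ n * (s + n%:R * d)) <= (s + d) * ((s + d) ^+ n * s).
  by rewrite ler_wpM2l // addr_ge0.
apply: le_trans; rewrite -natr1.
have -> : (s + d) * (s ^+ n * (s + n%:R * d)) =
    s * s ^+ n * (s + (n%:R + 1) * d) + s ^+ n * (n%:R * (d * d)) by ring.
by rewrite lerDl !mulr_ge0.
Qed.

(* Suppose [t < 0] lies in the spectrum of [y = x^* x], and let [c = x (s - y)^n]
   with [s = |y|]. The spectrum of [c^* c = y (s - y)^(2n)] is at most
   [s^(2n+1)], hence so is that of [c c^*], and [c^* c + c c^* >= 0] forces
   [t (s - t)^(2n) >= - s^(2n+1)], which fails for large [n]. *)
Lemma positive_star_mul x : positive (star x * x).
Proof.
pose y := star x * x; rewrite -/y.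
have yy : star y = y by rewrite starM starK.
apply/positiveP; split=> // t st; rewrite leNgt; apply/negP => t0.
pose s := nrm y.
have ub (u : R) : spectrum y u%:C -> `|u| <= s.
  by move/spectrum_nrm; rewrite normc_def /= expr0n addr0 sqrtr_sqr.
have ts := ub _ st.
have s0 : 0 < s by apply: lt_le_trans ts; rewrite normr_gt0 lt_eqF.
suff key n : - (s ^+ n * s * s ^+ n) <= (s - t) ^+ n * t * (s - t) ^+ n.
  (* For [n t^2 > s^2], Bernoulli gives [(s - t)^n (- t) > s^n s]; as also [(s - t)^n >= s^n], this
     contradicts [key]. *)
  pose n := (Num.truncn (s ^+ 2 / t ^+ 2)).+1.
  have nE : s ^+ 2 / t ^+ 2 < n%:R by exact: truncnS_gt.
  have {nE} : s ^+ 2 < n%:R * t ^+ 2.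
    by rewrite -ltr_pdivrMr // exprn_even_gt0 //= lt_eqF.
  have td : 0 <= - t by rewrite oppr_ge0 ltW.
  have := key n; have := @bernoulli_le s (- t) n (ltW s0) td.
  set P := (s - t) ^+ n; set S := s ^+ n => h1 h2 h3.
  have S0 : 0 < S by rewrite exprn_gt0.
  have h4 : 0 <= S * (n%:R * - t) by rewrite !mulr_ge0 ?ltW // oppr_gt0.
  have PS : S <= P by rewrite -(ler_pM2r s0); lra.
  have Pd : S * s < P * - t.
    rewrite -(ltr_pM2r s0).
    have h5 : S * (s + n%:R * - t) * - t <= P * s * - t by exact: ler_wpM2r h1.
    have h6 : S * s ^+ 2 < S * (n%:R * t ^+ 2) by rewrite ltr_pM2l.
    have h7 : 0 < S * s * - t by rewrite !mulr_gt0 // oppr_gt0.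
    lra.
  have h8 : S * s * S <= S * s * P by rewrite ler_wpM2l // mulr_ge0 // ltW.
  have h9 : S * s * P < P * - t * P by rewrite ltr_pM2r // (lt_le_trans S0).
  suff : P * t * P < - (S * s * S) by rewrite ltNge h2.
  lra.
pose T := s%:C%:A - y; pose c := x * T ^+ n.
pose q : {poly R[i]} := (s%:C%:P - 'X) ^+ n * 'X * (s%:C%:P - 'X) ^+ n.
have cc : star c * c = horner_alg y q.
  rewrite !rmorphM /= !rmorphXn /= rmorphB /= horner_algC horner_algX.
  by rewrite starM starX starB star_real yy !mulrA.
have q1 : (1 < size q)%N.
  apply: (@root_size_gt1 _ 0); last by rewrite /root !hornerM hornerX mulr0 mul0r.
  rewrite !mulf_neq0 ?polyX_eq0 // expf_eq0 negb_and; apply/orP; right;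
  rewrite subr_eq0 eq_sym; apply/eqP => /(congr1 (size \o polyseq)) /=;
  rewrite size_polyX size_polyC; by case: (_ == _).
have qE (u : R) : q.[u%:C] = ((s - u) ^+ n * u * (s - u) ^+ n)%:C.
  by rewrite /q !hornerE !rmorphM !rmorphXn /= rmorphB.
(* Non-zero spectral values of [c c^*] are values [q(u)] with [u] in [[- s, s]]: they are
   nonpositive for [u <= 0], and at most [s^(2n+1)] for [u > 0]. *)
have pE : positive ((s ^+ n * s * s ^+ n)%:C%:A - c * star c).
  apply/positiveP; split; first by rewrite starB star_real starM starK.
  move=> l /spectrum_subr; rewrite -rmorphB /=.
  set E := s ^+ n * s * s ^+ n; have [|El] := eqVneq (E - l) 0.
    by move=> /subr0_eq <- _; rewrite !mulr_ge0 ?exprn_ge0 ?ltW.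
  move/spectrum_mulC; rewrite fmorph_eq0 => /(_ El); rewrite cc.
  move=> /(horner_alg_spectrum q1)[m sm]; rewrite (spectrum_real yy sm) qE => -[].
  have := spectrum_real yy sm => mE; rewrite mE in sm; move/ub : sm.
  set u := complex.Re m; rewrite ler_norml => /andP[us1 us2].
  suff : (s - u) ^+ n * u * (s - u) ^+ n <= E by lra.
  have [u0|u0] := leP u 0.
    apply: (@le_trans _ _ 0); last by rewrite !mulr_ge0 ?exprn_ge0 ?ltW.
    by rewrite mulrAC mulr_ge0_le0 // -expr2 sqr_ge0.
  have su : 0 <= s - u by rewrite subr_ge0.
  have h : (s - u) ^+ n <= s ^+ n by rewrite lerXn2r ?nnegrE // ?gerBl ltW.
  by rewrite !ler_pM ?mulr_ge0 ?exprn_ge0 // ltW.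
(* The sum is [c^* c + s^(2n+1)], and [q(t)] belongs to the spectrum of [c^* c]. *)
have := positiveD (positive_star_commute c) pE.
rewrite [X in _ + X]addrC addrA addrK => /positiveP[_ H].
rewrite lerNl -subr_ge0 opprK addrC; apply: H.
rewrite /spectrum /= rmorphD /= scalerDl opprD addrACA subrr addr0 -qE cc.
exact: spectrum_horner_alg.
Qed.

(* [p + d] has a self-adjoint square root [q], and [c^* q^2 c = (q c)^* (q c)]. *)
Lemma positive_conj c p : positive p -> positive (star c * p * c).
Proof.
move=> pp; apply: positive_lim => e e0.
have eP : nrm p < nrm p + e by rewrite ltrDl.
(* With [d K = e], the element [c^* p c + e] is [(q c)^* (q c) + d (K - c^* c)], and [K] exceeds
   [|c|^2]. *)
pose K := (nrm c ^+ 2 + 1); have K0 : 0 < K by rewrite ltr_wpDl ?exprn_ge0 ?nrm_ge0.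
pose d := e / K; have d0 : 0 < d by rewrite divr_gt0.
pose s := nrm p + d.
have [||q [qq q2 _]] := @sqrt_subr (s%:C%:A - p - d%:C%:A) s.
- by rewrite !starB !star_real pp.1.
- rewrite /s rmorphD /= scalerDl addrAC addrK.
  by apply: le_lt_trans (positive_nrm pp (lexx _)) _; rewrite ltrDl.
have pE : p + d%:C%:A = q * q by rewrite q2 -addrA -opprD subKr.
have -> : star c * p * c + e%:C%:A =
    star (q * c) * (q * c) + d%:C *: (K%:C%:A - star c * c).
  have -> : star (q * c) * (q * c) = star c * p * c + d%:C *: (star c * c).
    rewrite starM qq mulrA -(mulrA (star c)) -pE mulrDr mulrDl.
    by rewrite mulr_algr -scalerAl.
  rewrite scalerBr addrA addrAC addrK scalerA -rmorphM /=.
  by rewrite /d divfK // lt0r_neq0.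
apply: positiveD; first exact: positive_star_mul.
apply: positiveZ; first exact: ltW.
rewrite /K rmorphD /= scalerDl addrAC -nrmE; apply: positiveD.
  by apply: positive_selfadj; rewrite starM starK.
exact/positive_real.
Qed.

(** * The order on [A] *)

Lemma cstar_le_conj c a b : cstar_le a b -> cstar_le (star c * a * c) (star c * b * c).
Proof. by rewrite /cstar_le -mulrBl -mulrBr; exact: positive_conj. Qed.

Lemma cstar_le_trans b a c : cstar_le a b -> cstar_le b c -> cstar_le a c.
Proof. by move=> ab bc; rewrite /cstar_le -(subrKA b); exact: positiveD. Qed.

Lemma cstar_leD a b c h : cstar_le a b -> cstar_le c h -> cstar_le (a + c) (b + h).
Proof. by move=> ab ch; rewrite /cstar_le opprD addrACA; exact: positiveD. Qed.

Lemma cstar_leZ (r : R) a b : 0 <= r -> cstar_le a b -> cstar_le (r%:C *: a) (r%:C *: b).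
Proof. by move=> r0 ab; rewrite /cstar_le -scalerBr; exact: positiveZ. Qed.

Lemma cstar_lexx a : cstar_le a a.
Proof. by rewrite /cstar_le subrr; exact: positive0. Qed.

Lemma star_mul_le_nrm x (r : R) : nrm x ^+ 2 <= r -> cstar_le (star x * x) r%:C%:A.
Proof.
move=> xr; rewrite /cstar_le -(subrKA (nrm x ^+ 2)%:C%:A); apply: positiveD.
  by rewrite -scalerBl -rmorphB; apply: positive_real; rewrite subr_ge0.
by rewrite -nrmE; apply: positive_selfadj; rewrite starM starK.
Qed.

(** For [n = |p| > 0] and [k = n - p], the commuting elements [p], [k] satisfy
    [n (n p - p^2) = p k p + k p k], a sum of positive conjugates. *)
Lemma positive_sqr_le p : positive p -> cstar_le (p * p) ((nrm p)%:C *: p).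
Proof.
move=> pp; have pn := positive_selfadj pp.1.
have [p0|p0] := eqVneq (nrm p) 0.
  by move/nrm_eq0 : p0 => ->; rewrite mulr0 scaler0; exact: cstar_lexx.
set n := (nrm p)%:C in pn *; pose k := n%:A - p.
have n0 : n != 0 by rewrite fmorph_eq0.
have pk : k * p = p * k by rewrite mulrBl mulrBr mulr_algl mulr_algr.
have nE : n *: p - p * p = (nrm p)^-1%:C *: (star p * k * p + star k * p * k).
  have -> : star k = k by exact: pn.1.
  rewrite pp.1 pk -!mulrA -!mulrDr [p + k]addrC subrK mulr_algr -scalerAr scalerA.
  by rewrite -rmorphM /= mulVf // scale1r mulrBr mulr_algr.
rewrite /cstar_le nE; apply: positiveZ; first by rewrite invr_ge0 nrm_ge0.
by apply: positiveD; exact: positive_conj.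
Qed.

(** * From fullness to irreducibility *)

Lemma positives_full_irreducible B : unital_inclusion B ->
  (forall a, positive a -> a <> 0 -> full_relatively B a) -> cstar_irreducible B.
Proof.
move=> [sB B1] full D sD BD; have D1 := BD _ B1.
split=> [D0|I iI].
  by move: D1; rewrite D0 => /eqP; rewrite oner_eq0.
have [[x [Ix x0]]|H] := pselect (exists x, I x /\ x <> 0); [right|left].
  have ID := closed_ideal_sub iI.
  have a0 : star x * x <> 0.
    by move=> /(congr1 nrm); rewrite nrmE nrm0 => /eqP; rewrite expf_eq0 /= => /eqP/nrm_eq0.
  have [n [z [Bz]]] := full _ (positive_star_mul x) a0.
  set S := \sum_(j < n) _ => pS.
  have IS : I S.
    apply: (big_ind I); [exact: closed_ideal0 iI|exact: closed_idealD iI|].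
    move=> j _; apply: (closed_idealMr iI); last exact: BD.
    apply: (closed_idealMl iI); first exact/(subCStar_star sD)/BD.
    by apply: (closed_idealMl iI) => //; exact/(subCStar_star sD)/ID.
  (* Positivity of [S - 1] gives [|t - (S - 1)| <= t], so with [c = 1 / (t + 1)] one has
     [|1 - c S| <= t / (t + 1) < 1]. *)
  pose t := nrm (S - 1); have t0 : 0 <= t := nrm_ge0 _.
  have St := positive_nrm pS (lexx t).
  pose c := (t + 1)^-1; have c0 : 0 < c by rewrite invr_gt0 ltr_wpDl.
  have [||y [Dy yl _]] := @neumann D (1 - c%:C *: S) sD D1.
  - by apply: subCStarB => //; apply: (subCStarZ sD); exact: ID.
  - have -> : 1 - c%:C *: S = c%:C *: (t%:C%:A - (S - 1)).
      have -> : t%:C%:A - (S - 1) = (t + 1)%:C%:A - S.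
        by rewrite rmorphD /= scalerDl scale1r opprB addrA.
      rewrite scalerBr scalerA -rmorphM /= mulVf ?scale1r //.
      by rewrite lt0r_neq0 // ltr_wpDl.
    rewrite nrmZr gtr0_norm //.
    have := ler_wpM2l (ltW c0) St; have : c * (t + 1) = 1 by rewrite mulVf // lt0r_neq0 // ltr_wpDl.
    lra.
  have I1 : I 1.
    rewrite -yl subKr; apply: (closed_idealMl iI) => //; exact: closed_idealZ iI _ _ IS.
  apply/seteqP; split=> // d Dd; rewrite -[d]mulr1; exact: closed_idealMl iI _ _ Dd I1.
apply/seteqP; split=> [x Ix|x ->]; last exact: closed_ideal0 iI.
by apply: contrapT => x0; apply: H; exists x.
Qed.

(** * The cone generated by [a] and its hereditary subalgebra *)

Section RelativeHereditary.
Variables (B : set A) (a : A).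
Hypotheses (hB : unital_inclusion B) (pa : positive a).

(** Sequences make addition a concatenation; [conj_cone_full] converts them to the indexed families
    of [full_relatively]. *)
Definition conj_sum (s : seq A) : A := \sum_(z <- s) star z * a * z.

Definition conj_cone S := exists2 s : seq A, (forall z, z \in s -> B z) & S = conj_sum s.

Lemma conj_coneD S T : conj_cone S -> conj_cone T -> conj_cone (S + T).
Proof.
move=> [s sB ->] [t tB ->]; exists (s ++ t); last by rewrite /conj_sum big_cat.
by move=> z; rewrite mem_cat => /orP[/sB|/tB].
Qed.

Lemma conj_cone0 : conj_cone 0.
Proof. by exists [::]; rewrite // /conj_sum big_nil. Qed.

Lemma conj_cone_conj b S : B b -> conj_cone S -> conj_cone (star b * S * b).
Proof.
move=> Bb [s sB ->]; exists [seq z * b | z <- s].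
  by move=> _ /mapP[z /sB Bz ->]; exact: subCStarM hB.1 _ _ Bz Bb.
rewrite /conj_sum big_map mulr_sumr mulr_suml; apply: eq_bigr => z _.
by rewrite starM !mulrA.
Qed.

Lemma conj_coneZ (r : R) S : 0 <= r -> conj_cone S -> conj_cone (r%:C *: S).
Proof.
move=> r0 [s sB ->]; exists [seq (Num.sqrt r)%:C *: z | z <- s].
  by move=> _ /mapP[z /sB Bz ->]; exact: subCStarZ hB.1 _ _ Bz.
rewrite /conj_sum big_map scaler_sumr; apply: eq_bigr => z _.
by rewrite starZr -!scalerAl -scalerAr scalerA -rmorphM /= -expr2 sqr_sqrtr.
Qed.

Lemma conj_cone_gen : conj_cone a.
Proof.
exists [:: 1] => [z|]; first by rewrite inE => /eqP ->; exact: hB.2.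
by rewrite /conj_sum big_seq1 star1 mul1r mulr1.
Qed.

(** The hypothesis says [S >= 1/2], and [2 S] is still in the cone. *)
Lemma conj_cone_full S : conj_cone S -> cstar_le 1 (S + 2^-1%:C%:A) -> full_relatively B a.
Proof.
move=> /(conj_coneZ (ler0n R 2))[s sB sE] h.
exists (size s), (fun j => nth 0 s j); split=> [j|]; first exact/sB/mem_nth.
have -> : \sum_(j < size s) star (nth 0 s j) * a * nth 0 s j = 2%:C *: S.
  by rewrite sE /conj_sum (big_nth 0) big_mkord.
rewrite /cstar_le.
have -> : 2%:C *: S - 1 = 2%:C *: (S + 2^-1%:C%:A - 1).
  rewrite scalerBr scalerDr scalerA -rmorphM /= divff // scale1r.
  by rewrite (_ : 2%:C *: 1 = 1 + 1) ?opprD ?addrA ?addrK // [2%:C]rmorphD /= scalerDl scale1r.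
exact: positiveZ.
Qed.

(* The elements [x] whose [x^* x] is dominated by the cone up to any [e > 0]
   form a closed left ideal of [A]; its intersection with its adjoint is the
   hereditary subalgebra [H]. *)
Definition dominated x := forall e : R, 0 < e ->
  exists2 S, conj_cone S & cstar_le (star x * x) (S + e%:C%:A).

(** By the parallelogram identity the difference is [(x - y)^* (x - y)]. *)
Lemma star_mulD_le x y :
  cstar_le (star (x + y) * (x + y)) (2%:C *: (star x * x + star y * y)).
Proof.
rewrite /cstar_le.
have -> : 2%:C *: (star x * x + star y * y) - star (x + y) * (x + y) = star (x - y) * (x - y).
  rewrite starD starB !(mulrDl, mulrDr, mulrN, mulNr) opprK.
  rewrite [2%:C]rmorphD /= scalerDl !scale1r !(opprD, addrA).
  rewrite [LHS](ACl ((1 * 5) * (2 * 8) * 3 * 6 * 7 * 4)) /=.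
  by rewrite !subrr !add0r.
exact: positive_star_mul.
Qed.

Lemma dominated0 : dominated 0.
Proof.
move=> e e0; exists 0; first exact: conj_cone0.
by rewrite mulr0 add0r /cstar_le subr0; exact/positive_real/ltW.
Qed.

Lemma dominatedD x y : dominated x -> dominated y -> dominated (x + y).
Proof.
move=> dx dy e e0; have e4 : 0 < e / 4 by rewrite divr_gt0.
have [S kS xS] := dx _ e4; have [T kT yT] := dy _ e4.
exists (2%:C *: (S + T)); first exact/conj_coneZ/conj_coneD.
apply: cstar_le_trans (star_mulD_le _ _) _.
have -> : 2%:C *: (S + T) + e%:C%:A = 2%:C *: ((S + (e / 4)%:C%:A) + (T + (e / 4)%:C%:A)).
  rewrite addrACA [RHS]scalerDr -scalerDl -rmorphD scalerA -rmorphM /=.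
  by congr (_ + _%:C%:A); field.
by apply: cstar_leZ => //; exact: cstar_leD.
Qed.

(** Here [z] is arbitrary in [A], since [x^* z^* z x <= r x^* x]; the [+ 1] in [r] allows division
    by it. *)
Lemma dominatedMl z x : dominated x -> dominated (z * x).
Proof.
move=> dx e e0; pose r := nrm z ^+ 2 + 1.
have r0 : 0 < r by rewrite ltr_wpDl ?exprn_ge0 ?nrm_ge0.
have [S kS xS] := dx _ (divr_gt0 e0 r0).
exists (r%:C *: S); first exact/conj_coneZ/kS/ltW.
apply: (@cstar_le_trans (r%:C *: (star x * x))).
  have -> : star (z * x) * (z * x) = star x * (star z * z) * x by rewrite starM !mulrA.
  have -> : r%:C *: (star x * x) = star x * r%:C%:A * x by rewrite mulr_algr -scalerAl.
  by apply/cstar_le_conj/star_mul_le_nrm; rewrite lerDl.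
have -> : r%:C *: S + e%:C%:A = r%:C *: (S + (e / r)%:C%:A).
  by rewrite scalerDr scalerA -rmorphM /= mulrC divfK // lt0r_neq0.
by apply: cstar_leZ => //; exact: ltW.
Qed.

(** Here [b] must conjugate the cone into itself, whence [B b]; the error term is absorbed by
    [b^* b <= r]. *)
Lemma dominatedMr b x : B b -> dominated x -> dominated (x * b).
Proof.
move=> Bb dx e e0; pose r := nrm b ^+ 2 + 1.
have r0 : 0 < r by rewrite ltr_wpDl ?exprn_ge0 ?nrm_ge0.
have [S kS xS] := dx _ (divr_gt0 e0 r0).
exists (star b * S * b); first exact: conj_cone_conj.
have -> : star (x * b) * (x * b) = star b * (star x * x) * b by rewrite starM !mulrA.
apply: cstar_le_trans (cstar_le_conj b xS) _.
rewrite mulrDr mulrDl; apply: cstar_leD; first exact: cstar_lexx.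
rewrite mulr_algr -scalerAl.
have -> : e%:C%:A = (e / r)%:C *: r%:C%:A :> A by rewrite scalerA -rmorphM /= divfK // lt0r_neq0.
apply: cstar_leZ; first by rewrite divr_ge0 // ltW.
by apply: star_mul_le_nrm; rewrite lerDl.
Qed.

Lemma dominated_closed : closed dominated.
Proof.
(* The bound by 1 gives [|x - y|^2 <= |x - y| < e / 4]. *)
apply/closed_nrmP => x H e e0; pose d := Num.min 1 (e / 4).
have d0 : 0 < d by rewrite lt_min ltr01 divr_gt0.
have [y dy xy] := H _ d0; have e4 : 0 < e / 4 by rewrite divr_gt0.
have [S kS yS] := dy _ e4.
exists (2%:C *: S); first exact/conj_coneZ/kS.
rewrite -{1 2}(subrK y x); apply: cstar_le_trans (star_mulD_le _ _) _.
have -> : 2%:C *: S + e%:C%:A = 2%:C *: ((e / 4)%:C%:A + (S + (e / 4)%:C%:A)).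
  rewrite addrCA [RHS]scalerDr -scalerDl -rmorphD scalerA -rmorphM /=.
  by congr (_ + _%:C%:A); field.
apply: cstar_leZ => //; apply: cstar_leD => //; apply: star_mul_le_nrm.
have := nrm_ge0 (x - y); move: xy; rewrite lt_min => /andP[x1 x4] x0.
apply: le_trans (ltW x4); rewrite expr2 ler_piMl // ltW //.
Qed.

(** Expanding [(b - e)^2 >= 0] gives [2 e b <= b^2 + e^2]. Since [b^2] is dominated up to [e^2],
    dividing by [2 e] leaves the error [e]. *)
Lemma dominated_selfadj b (e : R) : star b = b -> dominated b -> 0 < e ->
  exists2 S, conj_cone S & cstar_le b (S + e%:C%:A).
Proof.
move=> bb db e0; have [S kS bS] := db _ (exprn_gt0 2 e0).
exists ((2 * e)^-1%:C *: S); first by apply: conj_coneZ => //; rewrite invr_ge0 mulr_ge0 // ltW.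
have h : cstar_le ((2 * e)%:C *: b) (b * b + (e ^+ 2)%:C%:A).
  rewrite /cstar_le.
  have -> : b * b + (e ^+ 2)%:C%:A - (2 * e)%:C *: b = star (b - e%:C%:A) * (b - e%:C%:A).
    rewrite starB star_real bb mulrBl !mulrBr mulr_algl mulr_algr.
    rewrite mulr_algl scalerA -rmorphM /= (expr2 e) (_ : 2 * e = e + e); last by ring.
    rewrite rmorphD /= scalerDl opprB opprD !addrA.
    by rewrite [LHS](ACl (1 * 3 * 2 * 4)).
  exact: positive_star_mul.
have e2 : (2 * e)%:C != 0 :> R[i] by rewrite fmorph_eq0 mulf_neq0 // lt0r_neq0.
have -> : b = (2 * e)^-1%:C *: ((2 * e)%:C *: b) by rewrite fmorphV scalerA mulVf // scale1r.
have -> : (2 * e)^-1%:C *: S + e%:C%:A =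
    (2 * e)^-1%:C *: (S + (e ^+ 2)%:C%:A + (e ^+ 2)%:C%:A).
  rewrite -addrA -scalerDl scalerDr scalerA -rmorphD -rmorphM /=.
  by congr (_ + _%:C%:A); field; rewrite lt0r_neq0.
apply: cstar_leZ; first by rewrite invr_ge0 mulr_ge0 // ltW.
apply: cstar_le_trans h _; apply: cstar_leD; last exact: cstar_lexx.
by rewrite -{1}bb.
Qed.

Definition rel_hereditary x := dominated x /\ dominated (star x).

Lemma rel_hereditary_subCStar : is_subCStar rel_hereditary.
Proof.
split.
- by split; rewrite ?star0; exact: dominated0.
- by move=> x y [dx dx'] [dy dy']; split; rewrite ?starD; exact: dominatedD.
- move=> l x [dx dx']; split; rewrite ?starZ -mulr_algl; exact: dominatedMl.
- by move=> x y [dx dx'] [dy dy']; split; rewrite ?starM; exact: dominatedMl.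
- by move=> x [dx dx']; split; rewrite ?starK.
have /closed_nrmP dC := dominated_closed.
apply/closed_nrmP => x H; split; apply: dC => e /H[y [dy dy'] xy].
  by exists y.
by exists (star y); rewrite // -starB nrm_star.
Qed.

Lemma rel_hereditary_gen : rel_hereditary a.
Proof.
suff da : dominated a by split; rewrite ?pa.1.
move=> e e0; exists ((nrm a)%:C *: a); first exact/conj_coneZ/conj_cone_gen/nrm_ge0.
rewrite pa.1; apply: cstar_le_trans (positive_sqr_le pa) _.
by rewrite /cstar_le addrAC subrr add0r; exact/positive_real/ltW.
Qed.

Lemma rel_hereditaryMl b x : B b -> rel_hereditary x -> rel_hereditary (b * x).
Proof.
move=> Bb [dx dx']; split; first exact: dominatedMl.
by rewrite starM; apply: dominatedMr => //; exact: subCStar_star hB.1 _ Bb.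
Qed.

Lemma rel_hereditaryMr b x : B b -> rel_hereditary x -> rel_hereditary (x * b).
Proof.
move=> Bb [dx dx']; split; first exact: dominatedMr.
by rewrite starM; exact: dominatedMl.
Qed.

(** For [0 <= c <= b] one has [c^2 <= |c| c <= (|c| + 1) b], and [b] itself, not only [b^2], is
    dominated by [dominated_selfadj]. *)
Lemma rel_hereditaryP : hereditary rel_hereditary.
Proof.
split=> [|c b pc cb [db _]]; first exact: rel_hereditary_subCStar.
suff dc : dominated c by split; rewrite ?pc.1.
have bb : star b = b.
  by have [] := cb; rewrite starB pc.1 => /addIr.
move=> e e0; have r0 : 0 < nrm c + 1 by rewrite ltr_wpDl ?nrm_ge0.
have [S kS bS] := dominated_selfadj bb db (divr_gt0 e0 r0).
exists ((nrm c + 1)%:C *: S); first exact/conj_coneZ/kS/ltW.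
have -> : (nrm c + 1)%:C *: S + e%:C%:A = (nrm c + 1)%:C *: (S + (e / (nrm c + 1))%:C%:A).
  by rewrite scalerDr scalerA -rmorphM /= mulrC divfK // lt0r_neq0.
rewrite pc.1; apply: cstar_le_trans (positive_sqr_le pc) _.
apply: (@cstar_le_trans ((nrm c + 1)%:C *: c)).
  by rewrite /cstar_le -scalerBl -rmorphB addrAC subrr add0r scale1r.
by apply: cstar_leZ; [exact: ltW|exact: cstar_le_trans bS].
Qed.

Lemma rel_hereditary1_full : rel_hereditary 1 -> full_relatively B a.
Proof.
have h : 0 < 2^-1 :> R by rewrite invr_gt0.
by move=> [/(_ _ h)[S kS]]; rewrite star1 mulr1 => le1 _; exact: conj_cone_full le1.
Qed.

Lemma full_projection p : rel_hereditary p -> projection p -> full_relatively B p ->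
  full_relatively B a.
Proof.
move=> [dp _] [pp p2] [n [x [Bx le1]]].
pose M := \sum_(j < n) nrm (x j) ^+ 2.
have M0 : 0 <= M by apply: sumr_ge0 => j _; exact: sqr_ge0.
have M1 : 0 < 2 * (M + 1) by rewrite mulr_gt0 // ltr_wpDl.
(* From [p = p^* p <= S + e] follows [1 <= T + e M], and this [e] makes [e M <= 1/2], the slack
   allowed by [conj_cone_full]. *)
pose e := (2 * (M + 1))^-1; have e0 : 0 < e by rewrite invr_gt0.
have [S kS] := dp e e0; rewrite pp p2 => pS.
pose T := \sum_(j < n) star (x j) * S * x j.
have kT : conj_cone T.
  apply: (big_ind conj_cone); [exact: conj_cone0|exact: conj_coneD|].
  by move=> j _; exact: conj_cone_conj.
apply: (conj_cone_full kT); apply: cstar_le_trans le1 _.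
apply: (@cstar_le_trans (T + (e * M)%:C%:A)).
  rewrite /T /M mulr_sumr rmorph_sum scaler_suml -big_split /=.
  apply: (big_ind2 (@cstar_le R A)); [exact: cstar_lexx|by move=> *; exact: cstar_leD|].
  move=> j _; apply: cstar_le_trans (cstar_le_conj _ pS) _.
  rewrite mulrDr mulrDl; apply: cstar_leD; first exact: cstar_lexx.
  rewrite mulr_algr -scalerAl rmorphM /= -scalerA; apply: cstar_leZ; first exact: ltW.
  exact: star_mul_le_nrm.
apply: cstar_leD; first exact: cstar_lexx.
rewrite /cstar_le -scalerBl -rmorphB; apply: positive_real; rewrite subr_ge0.
by rewrite /e mulrC ler_pdivrMr //; lra.
Qed.

(** * The idealizer and the two fullness criteria *)

Definition rel_idealizer d := forall h, rel_hereditary h ->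
  rel_hereditary (d * h) /\ rel_hereditary (h * d).

Lemma rel_idealizer_subCStar : is_subCStar rel_idealizer.
Proof.
have sH := rel_hereditary_subCStar; have /closed_nrmP cH := subCStar_closed sH.
split.
- by move=> h hh; rewrite mul0r mulr0; split; exact: subCStar0.
- move=> x y dx dy h hh; have [x1 x2] := dx h hh; have [y1 y2] := dy h hh.
  by rewrite mulrDl mulrDr; split; exact: subCStarD.
- move=> l x dx h hh; have [x1 x2] := dx h hh.
  by rewrite -scalerAl -scalerAr; split; exact: subCStarZ.
- move=> x y dx dy h hh; have [x1 x2] := dx h hh; have [y1 y2] := dy h hh.
  by split; [rewrite -mulrA; exact: (dx _ y1).1|rewrite mulrA; exact: (dy _ x2).2].
- move=> x dx h /(subCStar_star sH)/dx[/(subCStar_star sH) + /(subCStar_star sH)].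
  by rewrite !starM starK.
apply/closed_nrmP => x H h hh.
have h1 : 0 < nrm h + 1 by rewrite ltr_wpDl ?nrm_ge0.
split; apply: cH => e e0; have [y dy xy] := H _ (divr_gt0 e0 h1).
  exists (y * h); first exact: (dy _ hh).1.
  rewrite -mulrBl; apply: le_lt_trans (nrmM _ _) _.
  move: xy; rewrite ltr_pdivlMr //; have := nrm_ge0 (x - y); lra.
exists (h * y); first exact: (dy _ hh).2.
rewrite -mulrBr; apply: le_lt_trans (nrmM _ _) _.
move: xy; rewrite ltr_pdivlMr //; have := nrm_ge0 (x - y); lra.
Qed.

Lemma rel_hereditary_ideal : is_closed_ideal rel_idealizer rel_hereditary.
Proof.
have sH := rel_hereditary_subCStar; split.
- by move=> x hx h hh; split; exact: subCStarM.
- exact: subCStar0 sH.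
- exact: subCStarD sH.
- exact: subCStarZ sH.
- by move=> x y dx hy; exact: (dx _ hy).1.
- by move=> x y hx dy; exact: (dy _ hx).2.
- exact: subCStar_closed sH.
Qed.

Lemma irreducible_full : a <> 0 -> cstar_irreducible B -> full_relatively B a.
Proof.
move=> a0 irr; have sub : B `<=` rel_idealizer.
  by move=> b Bb h hh; split; [exact: rel_hereditaryMl|exact: rel_hereditaryMr].
have [_ /(_ _ rel_hereditary_ideal)[H0|HD]] := irr _ rel_idealizer_subCStar sub.
  by case: a0; have := rel_hereditary_gen; rewrite H0.
by apply: rel_hereditary1_full; rewrite HD; exact/sub/hB.2.
Qed.

Lemma SP_full : a <> 0 -> property_SP A ->
  (forall p, projection p -> p <> 0 -> full_relatively B p) -> full_relatively B a.
Proof.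
move=> a0 sp full; have H0 : rel_hereditary <> [set 0].
  by move=> H0; apply: a0; have := rel_hereditary_gen; rewrite H0.
have [p [Hp pp p0]] := sp _ rel_hereditaryP H0.
exact: full_projection Hp pp (full _ pp p0).
Qed.

End RelativeHereditary.
End CStarAlgebra.

Theorem proposition3p7 (R : realType) (A : cstarAlgType R) (B : set A)
    (hB : unital_inclusion B) :
  (cstar_irreducible B <->
     (forall a : A, positive a -> a <> 0 -> full_relatively B a)) /\
  (property_SP A ->
     (forall p : A, projection p -> p <> 0 -> full_relatively B p) ->
     cstar_irreducible B).
Proof.
split; first split.
- by move=> irr a pa a0; exact: irreducible_full.
- exact: positives_full_irreducible.
move=> sp full; apply: positives_full_irreducible => // a pa a0.
exact: SP_full.
Qed.
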